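(* Let $\mathbf{H}\in\mathbb{R}^{p\times p}$ be either an (orthonormal) Hadamard matrix or an (orthonormal) DCT matrix, let $\mathbf{D}\in\mathbb{R}^{p\times p}$ be a random diagonal matrix whose diagonal entries are independent and uniform on $\{\pm1\}$, and let $\eta=1$ if $\mathbf{H}$ is a Hadamard matrix and $\eta=1/2$ if $\mathbf{H}$ is a DCT matrix. Let $1\le m\le p$ and $\alpha\in(0,1)$. (i) Let $\mathbf{x}\in\mathbb{R}^p$, $\mathbf{y}=\mathbf{H}\mathbf{D}\mathbf{x}$, and let $\mathbf{w}\in\mathbb{R}^p$ be a sampled version of $\mathbf{y}$, keeping $m$ of its $p$ entries chosen uniformly at random without replacement (the other entries being set to zero). Then with probability greater than $1-\alpha$, $$\|\mathbf{w}\|_2^2\le\frac mp\,\frac2\eta\log\Big(\frac{2p}\alpha\Big)\|\mathbf{x}\|_2^2 .$$ (ii) Let $\mathbf{X}=[\mathbf{x}_1,\dots,\mathbf{x}_n]\in\mathbb{R}^{p\times n}$ and let $\mathbf{w}_1,\dots,\mathbf{w}_n\in\mathbb{R}^p$ be sampled versions, in the same sense, of the columns of the preconditioned data $\mathbf{Y}=\mathbf{H}\mathbf{D}\mathbf{X}$. Then with probability greater than $1-\alpha$, $$\|\mathbf{w}_i\|_2^2\le\frac mp\,\frac2\eta\log\Big(\frac{2np}\alpha\Big)\|\mathbf{x}_i\|_2^2\quad\text{for all } i=1,\dots,n .$$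
   Context: A Hadamard matrix here is normalized to be orthonormal, so its entries are $\pm1/\sqrt p$ (it is assumed to exist for the given $p$); the DCT matrix is the orthonormal discrete cosine transform matrix, whose entries are bounded in absolute value by $\sqrt{2/p}$. The vectors $\mathbf{x}$, $\mathbf{x}_i$ are deterministic. *)

(* Defs.v *)
From HB Require Import structures.
From mathcomp Require Import all_boot all_order all_algebra.
From mathcomp Require Import all_classical all_reals all_analysis.

Set Implicit Arguments.
Unset Strict Implicit.
Unset Printing Implicit Defensive.

Import Order.TTheory GRing.Theory Num.Theory.

Local Open Scope classical_set_scope.
Local Open Scope ring_scope.

(* The library norm `|v| on matrices is the sup norm. *)
Definition norm2 (R : realType) (p : nat) (v : 'cV[R]_p) : R :=
  Num.sqrt (\sum_(i < p) v i 0 ^+ 2).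

Definition orthonormal_mx (R : realType) (p : nat) (H : 'M[R]_p) : Prop :=
  H *m H^T = 1%:M.

Definition hadamard_mx (R : realType) (p : nat) (H : 'M[R]_p) : Prop :=
  (forall i j, H i j = 1 / Num.sqrt p%:R \/ H i j = - 1 / Num.sqrt p%:R)
  /\ orthonormal_mx H.

(* The orthonormal type-II DCT: row k is the sampled cosine of frequency k,
   and row 0 has its own normalization. *)
Definition dct_mx (R : realType) (p : nat) : 'M[R]_p :=
  \matrix_(k < p, j < p)
    ((if (k : nat) == 0%N then Num.sqrt (1 / p%:R) else Num.sqrt (2 / p%:R))
     * cos (pi * (2 * j%:R + 1) * k%:R / (2 * p%:R))).

Definition mutually_independent (d : measure_display) (T : measurableType d)
    (R : realType) (P : probability T R) (I : finType)
    (X : I -> {RV P >-> R}) : Prop :=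
  forall (J : {set I}) (A : I -> set R),
    (forall i, i \in J -> measurable (A i)) ->
    P [set t | forall i, i \in J -> X i t \in A i]
      = (\prod_(i in J) P (X i @^-1` A i))%E.

Definition uniform_sign (d : measure_display) (T : measurableType d)
    (R : realType) (P : probability T R) (X : {RV P >-> R}) : Prop :=
  P (X @^-1` [set 1]) = (1 / 2 : R)%:E /\
  P (X @^-1` [set - 1]) = (1 / 2 : R)%:E.

Definition sign_diag_mx (d : measure_display) (T : measurableType d)
    (R : realType) (P : probability T R) (p : nat)
    (eps : 'I_p -> {RV P >-> R}) (t : T) : 'M[R]_p :=
  diag_mx (\row_(i < p) eps i t).

(* S is a random m-element subset of the p coordinates, all 'C(p, m) such
   subsets being equally likely: sampling without replacement. Only the law of
   S is constrained, not its joint law with other random objects on T. *)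
Definition uniform_sample (d : measure_display) (T : measurableType d)
    (R : realType) (P : probability T R) (p m : nat)
    (S : T -> {set 'I_p}) : Prop :=
  forall A : {set 'I_p},
    measurable (S @^-1` [set A]) /\
    P (S @^-1` [set A]) =
      (if #|A| == m then ('C(p, m)%:R^-1 : R) else 0)%:E.

Definition sampled (R : realType) (p : nat) (S : {set 'I_p}) (y : 'cV[R]_p) :
    'cV[R]_p :=
  \col_(i < p) (if i \in S then y i 0 else 0).

(* Main.v *)
(** The sampling only enters through [#|S| = m], which holds almost surely: it
    suffices that every entry of [Y = H D X] satisfies
    [Y k i ^ 2 <= 2 / (eta p) * ln (2 n p / alpha) * |x_i|^2], whatever the joint
    law of the samples and the signs.  Each entry is a Rademacher sum with
    coefficients [H k j * X j i], and [H k j ^ 2 <= 1 / (eta p)], so Hoeffding's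
    inequality, from the moment generating function and [cosh x <= exp (x^2/2)],
    bounds each failure probability by [alpha / (n p)], and a union bound over
    the [n p] entries concludes.  Independence makes all [2 ^ p] sign patterns
    equiprobable, so probabilities become counts over [{ffun 'I_p -> bool}].
    Part (i) is part (ii) with [n = 1]. *)
Require Import Defs.
From HB Require Import structures.
From mathcomp Require Import all_boot all_order all_algebra.
From mathcomp Require Import ring lra.
From mathcomp Require Import all_classical all_reals all_analysis.
From mathcomp Require Import measurable_realfun.

Set Implicit Arguments.
Unset Strict Implicit.
Unset Printing Implicit Defensive.

Import Order.TTheory GRing.Theory Num.Theory.
Import numFieldNormedType.Exports.

Local Open Scope classical_set_scope.
Local Open Scope ring_scope.

(** * Calculus: Gaussian bound on cosh *)

Lemma ge0_derive_ge (R : realType) (f df : R -> R) (x : R) :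
  0 <= x -> (forall y : R, is_derive y 1 f (df y)) ->
  (forall y, 0 <= y -> 0 <= df y) -> f 0 <= f x.
Proof.
move=> x0 fE df0.
have cf : {within `[0, x], continuous f}.
  apply: continuous_subspaceT => y; apply: differentiable_continuous.
  by apply/derivable1_diffP; have [] := fE y.
have [c + E] := MVT_segment x0 (fun y _ => fE y) cf.
rewrite in_itv /= => /andP[c0 _].
by rewrite -subr_ge0 E mulr_ge0 ?df0 ?subr0.
Qed.

(** The right side minus the left vanishes at 0 and has derivative [y * (expR y - expR (- y))],
    nonnegative for [0 <= y]. *)
Lemma sinh_le_mul_cosh (R : realType) (x : R) : 0 <= x ->
  expR x - expR (- x) <= x * (expR x + expR (- x)).
Proof.
move=> x0; rewrite -subr_ge0.
pose g (y : R) := y * (expR y + expR (- y)) - (expR y - expR (- y)).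
have := @ge0_derive_ge R g (fun y => y * (expR y - expR (- y))) x x0.
have -> : g 0 = 0 by rewrite /g mul0r oppr0 subrr subr0.
apply.
  move=> y; apply: is_derive_eq.
  rewrite /GRing.scale /=; ring.
by move=> y y0; rewrite mulr_ge0 // subr_ge0 ler_expR; lra.
Qed.

(** Both sides are even. For [0 <= x], the left side times [expR (- (x ^+ 2 / 2))] starts at 2 and
    is nonincreasing by [sinh_le_mul_cosh]; [g] is its negation, so that [ge0_derive_ge] applies. *)
Lemma cosh_le_expR_sqr (R : realType) (x : R) :
  expR x + expR (- x) <= 2 * expR (x ^+ 2 / 2).
Proof.
wlog x0 : x / 0 <= x => [H|].
  have [/H//|x0] := leP 0 x.
  by have := H (- x); rewrite opprK sqrrN addrC; apply; lra.
pose g (y : R) := - ((expR y + expR (- y)) * expR (- (y ^+ 2 / 2))).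
have := @ge0_derive_ge R g (fun y => (y * (expR y + expR (- y)) - (expR y - expR (- y))) * expR (- (y ^+ 2 / 2))) x x0.
rewrite /g expr0n /= mul0r !oppr0 expR0 lerN2 mulr1 => H.
rewrite -ler_pdivrMr ?expR_gt0 // -expRN; apply: H.
  move=> y; apply: is_derive_eq.
  rewrite /GRing.scale /= expRN; lra.
by move=> y y0; rewrite mulr_ge0 ?expR_ge0 // subr_ge0 sinh_le_mul_cosh.
Qed.

(** * Rademacher sums, as sums over sign patterns *)

(** By distributivity the sum over patterns factors into one [expR (a j) + expR (- a j)] per
    coordinate. *)
Lemma sum_expR_sign_le (R : realType) (p : nat) (a : 'I_p -> R) :
  \sum_(s : {ffun 'I_p -> bool}) expR (\sum_j a j * (-1) ^+ s j) <=
  2 ^+ p * expR ((\sum_j a j ^+ 2) / 2).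
Proof.
under eq_bigr do rewrite expR_sum.
rewrite -(bigA_distr_bigA (fun j (b : bool) => expR (a j * (-1) ^+ b))).
have -> : 2 ^+ p = \prod_(j < p) (2 : R) by rewrite prodr_const card_ord.
rewrite mulr_suml expR_sum -big_split /=.
apply: ler_prod => j _; rewrite big_bool /= expr1 expr0 mulr1 mulrN1 addrC.
by rewrite addr_ge0 ?expR_ge0 ?cosh_le_expR_sqr.
Qed.

(* The inequality is strict because the exponential majorant
   [exp (lam Y - lam t) + exp (- lam Y - lam t)] of the indicator of [t < |Y|]
   is strict at every sign pattern. *)
Lemma sign_tail_card_lt (R : realType) (p : nat) (a : 'I_p -> R) (v L : R) :
  \sum_j a j ^+ 2 <= v -> 0 < L ->
  (\sum_(s : {ffun 'I_p -> bool} |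
      (2 * v * L < (\sum_j a j * (-1) ^+ s j) ^+ 2)) 1
    < 2 * 2 ^+ p * expR (- L) :> R).
Proof.
move=> av L0.
have r0 : 0 < 2 * 2 ^+ p * expR (- L) by rewrite !mulr_gt0 ?exprn_gt0 ?expR_gt0.
(* If [v <= 0], all coefficients vanish and the event reads [0 < 0]; the choice of [lam] below
   divides by [v]. *)
have [v0|v0] := leP v 0.
  rewrite big_pred0 // => s; apply/negbTE; rewrite -leNgt.
  have a0 j : a j = 0.
    apply/eqP; rewrite -sqrf_eq0 eq_le sqr_ge0 andbT.
    apply: le_trans (le_trans av v0).
    by rewrite (bigD1 j) //= lerDl sumr_ge0 // => i _; rewrite sqr_ge0.
  have v00 : v = 0.
    apply/eqP; rewrite eq_le v0; apply: le_trans av.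
    by rewrite sumr_ge0 // => i _; rewrite sqr_ge0.
  by rewrite big1 ?v00 => [|j _]; rewrite ?a0 ?mul0r // expr0n mulr0 mul0r.
(* The event is [t < |Y|], and [lam = t / v] minimizes the Chernoff exponent [lam^2 v / 2 - lam t],
   whose value is then [L - 2 L = - L]. *)
pose lam := Num.sqrt (2 * L / v); pose t := Num.sqrt (2 * v * L).
have lam2 : lam ^+ 2 = 2 * L / v by rewrite sqr_sqrtr // divr_ge0 ?mulr_ge0 // ltW.
have lam0 : 0 < lam by rewrite sqrtr_gt0 divr_gt0 ?mulr_gt0.
have t0 : 0 <= t := sqrtr_ge0 _.
have t2 : t ^+ 2 = 2 * v * L by rewrite sqr_sqrtr // !mulr_ge0 // ltW.
have lamt : lam * t = 2 * L.
  rewrite -sqrtrM ?divr_ge0 ?mulr_ge0 ?(ltW L0) ?(ltW v0) //.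
  rewrite (_ : 2 * L / v * (2 * v * L) = (2 * L) ^+ 2); last by field; rewrite gt_eqF.
  by rewrite sqrtr_sqr ger0_norm // mulr_ge0 // ltW.
pose Y (c : R) (s : {ffun 'I_p -> bool}) := \sum_j (c * a j) * (-1) ^+ s j.
have YE c s : Y c s = c * Y 1 s.
  by rewrite /Y mulr_sumr; apply: eq_bigr => j _; rewrite mul1r mulrA.
have Y1 (s : {ffun 'I_p -> bool}) : \sum_j a j * (-1) ^+ s j = Y 1 s.
  by apply: eq_bigr => j _; rewrite mul1r.
have mgf c : c ^+ 2 = lam ^+ 2 ->
    \sum_s expR (Y c s) <= 2 ^+ p * expR L.
  move=> c2; apply: le_trans (sum_expR_sign_le _) _.
  rewrite ler_wpM2l ?exprn_ge0 // ler_expR.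
  under eq_bigr do rewrite exprMn c2.
  rewrite -mulr_sumr lam2 [leRHS](_ : L = 2 * L / v * v / 2); last by field; rewrite gt_eqF.
  rewrite ler_wpM2r ?invr_ge0 // ler_wpM2l // divr_ge0 ?mulr_ge0 // ltW //.
have -> : 2 * 2 ^+ p * expR (- L) = (2 ^+ p * expR L + 2 ^+ p * expR L) * expR (- (2 * L)).
  rewrite (_ : - (2 * L) = - L - L); last by ring.
  rewrite expRD -mulrDl -mulr2n !mulrA.
  rewrite -(mulrA _ (expR L)) expRxMexpNx_1 mulr1 -mulr_natl; ring.
apply: (@lt_le_trans _ _ (\sum_s (expR (Y lam s) + expR (Y (- lam) s)) * expR (- (2 * L)))); last first.
  rewrite -mulr_suml big_split /= ler_wpM2r ?expR_ge0 // lerD ?mgf //.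
  by rewrite sqrrN.
rewrite big_mkcond /=; apply: ltr_sum.
  by apply/hasP; exists [ffun=> false]; rewrite ?mem_index_enum.
move=> s _; rewrite Y1 [ltRHS]mulrDl -!expRD (YE lam) (YE (- lam)) -lamt.
case: ifPn => [|_]; last by rewrite addr_gt0 ?expR_gt0.
rewrite -t2 => H.
have {}H : t < `|Y 1 s|.
  by rewrite -ltr_sqr ?nnegrE ?normr_ge0 ?t0 ?real_normK ?num_real.
(* The exponential matching the sign of [Y 1 s] is at least 1; the other one, being positive, gives
   strictness. *)
have [Y0|Y0] := leP 0 (Y 1 s).
  rewrite ger0_norm // in H.
  apply: ltr_pwDr; first exact: expR_gt0.
  by rewrite -[leLHS]expR0 ler_expR subr_ge0 ler_wpM2l // ltW.
rewrite ltr0_norm // in H.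
apply: ltr_pwDl; first exact: expR_gt0.
rewrite -[leLHS]expR0 ler_expR subr_ge0 mulNr -mulrN.
by rewrite ler_wpM2l // ltW.
Qed.

(** * Equidistribution of the sign patterns *)

Lemma measurable_sign_pattern d (T : measurableType d) (R : realType)
    (P : probability T R) (p : nat) (eps : 'I_p -> {RV P >-> R})
    (s : {ffun 'I_p -> bool}) :
  measurable [set t | forall j, eps j t = (-1) ^+ s j].
Proof.
rewrite (_ : [set _ | _] = \bigcap_(j in setT) eps j @^-1` [set (-1) ^+ s j]).
  apply: fin_bigcap_measurable; first exact: finite_finset.
  by move=> j _; exact: measurable_funPTI.
by apply/seteqP; split=> t /= h j; [move=> _; exact: h|exact: h j I].
Qed.

Lemma probability_sign_pattern d (T : measurableType d) (R : realType)
    (P : probability T R) (p : nat) (eps : 'I_p -> {RV P >-> R})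
    (s : {ffun 'I_p -> bool}) :
  mutually_independent eps -> (forall j, uniform_sign (eps j)) ->
  P [set t | forall j, eps j t = (-1) ^+ s j] = ((2 ^+ p)^-1)%:E.
Proof.
move=> ind unif.
have := ind [set: 'I_p]%SET (fun j => [set (-1) ^+ s j]).
rewrite (_ : [set t | forall i, i \in [set: 'I_p]%SET -> _] =
    [set t | forall j, eps j t = (-1) ^+ s j]); last first.
  apply/seteqP; split=> t /= h j.
    by have := h j; rewrite finset.in_setT => /(_ isT); rewrite inE.
  by move=> _; rewrite inE /=; exact: h.
move=> -> //.
rewrite (eq_bigr (fun=> (2^-1 : R)%:E)) => [|j _]; last first.
  have [h1 h2] := unif j.
  by case: (s j); rewrite ?expr0 ?expr1 ?h1 ?h2 mul1r.
by rewrite prodEFin prodr_const finset.cardsT card_ord exprVn.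
Qed.

(** Turns probabilities of sign events into counts: [U] is a finite disjoint union of patterns, each
    of probability [2 ^- p]. *)
Lemma probability_sign_event d (T : measurableType d) (R : realType)
    (P : probability T R) (p : nat) (eps : 'I_p -> {RV P >-> R})
    (G : pred {ffun 'I_p -> bool}) :
  mutually_independent eps -> (forall j, uniform_sign (eps j)) ->
  let U := [set t | exists2 s : {ffun 'I_p -> bool},
                      G s & forall j, eps j t = (-1) ^+ s j] in
  measurable U /\ P U = ((\sum_(s | G s) 1) / 2 ^+ p)%:E.
Proof.
move=> ind unif U.
pose F (s : {ffun 'I_p -> bool}) :=
  if G s then [set t | forall j, eps j t = (-1) ^+ s j] else set0.
have mF s : measurable (F s).
  by rewrite /F; case: ifP => // _; exact: measurable_sign_pattern.
have UE : U = \bigcup_(s in setT) F s.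
  apply/seteqP; split=> t /=.
    by move=> [s Gs h]; exists s => //; rewrite /F Gs.
  by move=> [s _]; rewrite /F; case: ifP => // Gs h; exists s.
split.
  by rewrite UE; apply: fin_bigcup_measurable => //; exact: finite_finset.
rewrite UE measure_fin_bigcup //; first last.
(* Disjointness: the values of the signs at a point determine the pattern. *)
- move=> s1 s2 _ _ [t]; rewrite /F; case: ifP => _; case: ifP => _; [|by case..].
  move=> [/= h1 h2]; apply/ffunP => j.
  by apply: (@signr_inj R); rewrite -h1 h2.
- exact: finite_finset.
rewrite (fsbigE (index_enum {ffun 'I_p -> bool})) //; first last.
- by move=> s _; rewrite mem_index_enum.
- exact: index_enum_uniq.
rewrite mulr_suml -sumEFin [RHS]big_mkcond /=; apply: eq_big => s; first by rewrite in_setT.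
move=> _; rewrite /F; case: ifP => _; last by rewrite measure0.
by rewrite probability_sign_pattern // mul1r.
Qed.

(** * Random subsets, norms and matrix entries *)

Lemma uniform_sample_card_negligible d (T : measurableType d) (R : realType)
    (P : probability T R) (p m : nat) (S : T -> {set 'I_p}) :
  uniform_sample P m S -> P.-negligible [set t | #|S t| <> m].
Proof.
move=> unif.
apply: (@negligibleS _ _ _ _
  (\big[setU/set0]_(A : {set 'I_p} | #|A| != m) S @^-1` [set A])).
  by move=> t /= /eqP Sm; rewrite -bigcup_pred; exists (S t).
elim/big_ind : _ => [|A B|A Am]; [exact: negligible_set0|exact: negligibleU|].
have [mA] := unif A; rewrite (negbTE Am) => PA.
by exists (S @^-1` [set A]); split.
Qed.

Lemma norm2_sqr (R : realType) (p : nat) (v : 'cV[R]_p) :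
  norm2 v ^+ 2 = \sum_(i < p) v i 0 ^+ 2.
Proof. by rewrite sqr_sqrtr // sumr_ge0 // => i _; rewrite sqr_ge0. Qed.

Lemma hadamard_or_dct_entry_sqr_le (R : realType) (p : nat) (H : 'M[R]_p)
    (eta : R) (k j : 'I_p) :
  (hadamard_mx H /\ eta = 1) \/ (H = dct_mx R p /\ eta = 1 / 2) ->
  H k j ^+ 2 <= (eta * p%:R)^-1.
Proof.
move=> [[[Hpm _] ->]|[-> ->]].
  rewrite mul1r -[X in X^-1](sqr_sqrtr (ler0n R p)) -exprVn.
  by have [->|->] := Hpm k j; rewrite ?mulN1r ?sqrrN ?mul1r.
rewrite mxE exprMn [leRHS](_ : _ = 2 / p%:R * 1); last first.
  by rewrite mulr1 invfM invf_div divr1.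
have cos1 (u : R) : cos u ^+ 2 <= 1 by rewrite -(cos2Dsin2 u) lerDl sqr_ge0.
apply: ler_pM (cos1 _); rewrite ?sqr_ge0 //.
(* Row 0 has squared normalization [1 / p], the other rows exactly [2 / p]. *)
by case: ifP => _; rewrite sqr_sqrtr ?divr_ge0 // ler_wpM2r ?invr_ge0 // ler1n.
Qed.

Lemma preconditioned_entry (R : realType) (d : measure_display)
    (T : measurableType d) (P : probability T R) (p n : nat) (H : 'M[R]_p)
    (eps : 'I_p -> {RV P >-> R}) (X : 'M[R]_(p, n)) (t : T) k i :
  (H *m sign_diag_mx eps t *m X) k i = \sum_j (H k j * X j i) * eps j t.
Proof.
rewrite mul_mx_diag mxE; apply: eq_bigr => j _.
by rewrite !mxE mulrAC.
Qed.

(** [S] takes finitely many values, each on a measurable set, so [k \in S t] is a measurable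
    condition. *)
Lemma measurable_norm2_sampled d (T : measurableType d) (R : realType)
    (P : probability T R) (p m : nat) (S : T -> {set 'I_p})
    (y : T -> 'cV[R]_p) (c : R) :
  uniform_sample P m S -> (forall k, measurable_fun setT (fun t => y t k 0)) ->
  measurable [set t | (norm2 (sampled (S t) (y t)) ^+ 2 <= c)%R].
Proof.
move=> unif my; rewrite -[X in measurable X]setTI.
apply: (measurable_fun_le measurableT); last exact: measurable_cst.
under eq_fun do rewrite norm2_sqr.
apply: measurable_sum => k; apply: measurable_funX.
under eq_fun do rewrite mxE.
apply: measurable_fun_ifT => //.
apply: (measurable_fun_bool true); rewrite setTI.
rewrite (_ : _ @^-1` _ = \bigcup_(A in [set A : {set 'I_p} | k \in A]) (S @^-1` [set A])).
  apply: fin_bigcup_measurable => [|A _]; first exact: finite_finset.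
  by have [] := unif A.
by apply/seteqP; split=> t /=; [exists (S t)|move=> [A /= kA ->]].
Qed.

(** * Union bound over the entries, and conclusion *)

Lemma preconditioned_tail (R : realType) (p n : nat) (H : 'M[R]_p)
    (eta alpha : R) (X : 'M[R]_(p, n)) :
  (0 < p)%N -> 0 < eta -> (forall k j, H k j ^+ 2 <= (eta * p%:R)^-1) ->
  0 < alpha -> alpha < 1 ->
  (\sum_(s : {ffun 'I_p -> bool} | ~~ [forall i, forall k,
      (\sum_j (H k j * X j i) * (-1) ^+ s j) ^+ 2 <=
      2 * ((eta * p%:R)^-1 * norm2 (col i X) ^+ 2)
        * ln (2 * n%:R * p%:R / alpha)]) 1 < alpha * 2 ^+ p :> R).
Proof.
move=> p0 eta0 HH a0 a1.
(* Without columns no pattern is bad; the strict sums below need a nonempty index set. *)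
have [n0|n0] := posnP n.
  rewrite big_pred0 ?mulr_gt0 ?exprn_gt0 // => s.
  by apply/negbF/forallP => i; exfalso; case: i; rewrite n0.
set L := ln _.
have np0 : 0 < 2 * n%:R * p%:R :> R by rewrite !mulr_gt0 ?ltr0n.
have np1 : 1 <= n%:R * p%:R :> R by rewrite -natrM ler1n muln_gt0 n0.
have L0 : 0 < L.
  by rewrite ln_gt0 // ltr_pdivlMr // mul1r; nra.
pose bad i k (s : {ffun 'I_p -> bool}) := 
  2 * ((eta * p%:R)^-1 * norm2 (col i X) ^+ 2) * L <
    (\sum_j (H k j * X j i) * (-1) ^+ s j) ^+ 2.
have badE i k : \sum_(s | bad i k s) 1 < 2 * 2 ^+ p * expR (- L).
  apply: sign_tail_card_lt => //.
  rewrite norm2_sqr mulr_sumr; apply: ler_sum => j _.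
  by rewrite exprMn mxE ler_wpM2r ?sqr_ge0.
(* [L] is chosen so that each of the [n p] two-sided tails counts fewer than [alpha 2^p / (n p)]
   patterns. *)
have eL : expR (- L) = alpha / (2 * n%:R * p%:R).
  by rewrite expRN lnK ?invf_div // posrE divr_gt0.
have -> : alpha * 2 ^+ p =
    \sum_(i < n) \sum_(k < p) (2 * 2 ^+ p * expR (- L)).
  rewrite !sumr_const !card_ord -mulrnA -[RHS]mulr_natr natrM eL.
  by field; rewrite !pnatr_eq0 -!lt0n n0 p0.
apply: (@le_lt_trans _ _ (\sum_(i < n) \sum_(k < p) \sum_(s | bad i k s) 1)).
  (* After exchanging sums, each bad pattern is counted at least once, at an entry [(i, k)] where it
     fails. *)
  under [leRHS]eq_bigr do rewrite (exchange_big_dep xpredT) //=.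
  rewrite (exchange_big_dep xpredT) //= [leLHS]big_mkcond /=; apply: ler_sum => s _.
  case: ifPn => [|_].
    move=> /forallPn[i /forallPn[k]]; rewrite -ltNge => ik.
    rewrite (bigD1 i) //= (bigD1 k) //= -addrA lerDl addr_ge0 ?sumr_ge0 //.
    by move=> i' _; rewrite sumr_ge0.
  by rewrite sumr_ge0 // => i _; rewrite sumr_ge0.
have hn : has xpredT (index_enum 'I_n) by apply/hasP; exists (Ordinal n0); rewrite ?mem_index_enum.
have hp : has xpredT (index_enum 'I_p) by apply/hasP; exists (Ordinal p0); rewrite ?mem_index_enum.
apply: ltr_sum => // i _; exact: ltr_sum.
Qed.

Lemma sampled_columns_bound (R : realType) (d : measure_display)
    (T : measurableType d) (P : probability T R) (p m n : nat) (H : 'M[R]_p)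
    (eta alpha : R) (eps : 'I_p -> {RV P >-> R}) (X : 'M[R]_(p, n))
    (S : 'I_n -> T -> {set 'I_p}) :
  (0 < p)%N -> 0 < eta -> (forall k j, H k j ^+ 2 <= (eta * p%:R)^-1) ->
  mutually_independent eps -> (forall j, uniform_sign (eps j)) ->
  0 < alpha -> alpha < 1 ->
  (forall i, uniform_sample P m (S i)) ->
  ((1 - alpha)%:E <
   P [set t | forall i : 'I_n,
        (norm2 (sampled (S i t) (col i (H *m sign_diag_mx eps t *m X))) ^+ 2 <=
        m%:R / p%:R * (2 / eta) * ln (2 * n%:R * p%:R / alpha)
          * norm2 (col i X) ^+ 2)%R])%E.
Proof.
move=> p0 eta0 HH ind unif a0 a1 unifS.
pose w i t := sampled (S i t) (col i (H *m sign_diag_mx eps t *m X)).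
set G := [set t | forall i, _].
pose L := ln (2 * n%:R * p%:R / alpha).
have mG : measurable G.
  rewrite (_ : G = \bigcap_(i in setT) [set t | (norm2 (w i t) ^+ 2 <=
        m%:R / p%:R * (2 / eta) * L * norm2 (col i X) ^+ 2)%R]); last first.
    by apply/seteqP; split=> t /= h i; [move=> _; exact: h|exact: h i I].
  apply: fin_bigcap_measurable => [|i _]; first exact: finite_finset.
  apply: measurable_norm2_sampled (unifS i) _ => k.
  under eq_fun do rewrite mxE preconditioned_entry.
  apply: measurable_sum => j; apply: measurable_funM => //.
pose good (s : {ffun 'I_p -> bool}) := [forall i, forall k,
      (\sum_j (H k j * X j i) * (-1) ^+ s j) ^+ 2 <=
      2 * ((eta * p%:R)^-1 * norm2 (col i X) ^+ 2) * L].
have [mU PU] := probability_sign_event good ind unif.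
set U := [set t | _] in mU PU.
have PU1 : ((1 - alpha)%:E < P U)%E.
  rewrite PU lte_fin ltr_pdivlMr ?exprn_gt0 //.
  have tail : \sum_(s | ~~ good s) 1 < alpha * 2 ^+ p :=
    preconditioned_tail X p0 eta0 HH a0 a1.
  have : \sum_(s : {ffun 'I_p -> bool}) 1 = 2 ^+ p :> R.
    by rewrite sumr_const card_ffun card_bool card_ord natrX.
  rewrite (bigID good) /= mulrBl mul1r => {1}<-.
  by rewrite ltrBlDr ltrD2l.
have [N [mN PN0 subN]] :
    P.-negligible (\bigcup_(i in [set` 'I_n]) [set t | #|S i t| <> m]).
  rewrite bigcup_pred; elim/big_ind : _ => [|A B|i _].
  - exact: negligible_set0.
  - exact: negligibleU.
  - exact: uniform_sample_card_negligible.
(* Enlarging [G] by the null set [N], which contains all points where some sample has the wrong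
   size, keeps its probability; it remains to see that [U] lies in the union. *)
apply: (lt_le_trans PU1); rewrite -(measureU0 (mu := P) mG mN PN0).
apply: le_measure; rewrite ?inE //; first exact: measurableU.
move=> t [s /forallP gs es].
have [Nt|Nt] := pselect (N t); [by right|left => i].
have St : #|S i t| = m.
  by apply: contrapT => Sm; apply: Nt; apply: subN; exists i.
rewrite norm2_sqr.
(* The bound splits into [m] equal shares, one per retained entry. *)
have -> : m%:R / p%:R * (2 / eta) * L * norm2 (col i X) ^+ 2 =
    \sum_(k in S i t) (2 * ((eta * p%:R)^-1 * norm2 (col i X) ^+ 2) * L).
  rewrite sumr_const St -[RHS]mulr_natr; field.
  by rewrite pnatr_eq0 -lt0n p0 gt_eqF.
rewrite [leRHS]big_mkcond; apply: ler_sum => k _.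
rewrite mxE; case: ifP => _; last by rewrite expr0n.
rewrite mxE preconditioned_entry.
under eq_bigr do rewrite es.
by have /forallP := gs i; apply.
Qed.

Theorem corollary3 (R : realType) (d : measure_display) (T : measurableType d)
    (P : probability T R) (p m : nat) (H : 'M[R]_p) (eta alpha : R)
    (eps : 'I_p -> {RV P >-> R}) :
  (hadamard_mx H /\ eta = 1) \/ (H = dct_mx R p /\ eta = 1 / 2) ->
  mutually_independent eps ->
  (forall i, uniform_sign (eps i)) ->
  (1 <= m)%N -> (m <= p)%N ->
  0 < alpha -> alpha < 1 ->
  (forall (x : 'cV[R]_p) (S : T -> {set 'I_p}),
     uniform_sample P m S ->
     let y := fun t => H *m sign_diag_mx eps t *m x in
     let w := fun t => sampled (S t) (y t) in
     ((1 - alpha)%:E <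
      P [set t | (norm2 (w t) ^+ 2 <=
           m%:R / p%:R * (2 / eta) * ln (2 * p%:R / alpha) * norm2 x ^+ 2)%R])%E)
  /\
  (forall (n : nat) (X : 'M[R]_(p, n)) (S : 'I_n -> T -> {set 'I_p}),
     (forall i, uniform_sample P m (S i)) ->
     let Y := fun t => H *m sign_diag_mx eps t *m X in
     let w := fun i t => sampled (S i t) (col i (Y t)) in
     ((1 - alpha)%:E <
      P [set t | forall i : 'I_n, (norm2 (w i t) ^+ 2 <=
           m%:R / p%:R * (2 / eta) * ln (2 * n%:R * p%:R / alpha)
             * norm2 (col i X) ^+ 2)%R])%E).
Proof.
move=> HE ind unif m1 mp a0 a1.
have p0 : (0 < p)%N := leq_trans m1 mp.
have eta0 : 0 < eta by case: HE => -[_ ->]; rewrite ?ltr01 ?divr_gt0.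
have HH k j := hadamard_or_dct_entry_sqr_le k j HE.
split=> [x S unifS|n X S unifS] /=; last exact: sampled_columns_bound.
(* The vector [x] is itself a matrix with one column, so [n = 1] and the factor [n%:R]
   disappears. *)
have := sampled_columns_bound x p0 eta0 HH ind unif a0 a1 (fun=> unifS).
have colE (v : 'cV[R]_p) : col 0 v = v.
  by apply/colP => k; rewrite mxE.
congr (_ < P _)%E; apply/seteqP; split=> t /=.
  by move=> /(_ 0); rewrite !colE mulr1.
by move=> h i; rewrite ord1 !colE mulr1.
Qed.
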